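(* Suppose that there exists an inner algorithm for $k$-dimensional \textsc{Tarski} that makes at most $q$ queries. Then a solution to the \textsc{Tarski} problem on a $k$-dimensional lattice of width $n$ can be found by making $O(q \cdot k \cdot \log n + k)$ queries.
   Context: For positive integers $n_1,\dots,n_k$, the lattice $L = L(n_1,\dots,n_k)$ is the set of all $x \in \mathbb{N}^k$ with $1 \le x_i \le n_i$, ordered by $x \preceq y$ iff $x_i \le y_i$ for all $i$; its width is $n=\max_i n_i$. The \textsc{Tarski} problem: given query access to $f : L \to L$ (a query is one evaluation of $f$), find either (T1) $x \in L$ with $f(x)=x$, or (T2) $x, y \in L$ with $x \preceq y$ and $f(x) \not\preceq f(y)$ (such $x,y$ witness a violation of order preservation of $f$). Define $\mathrm{Up}(f) = \{x : x \preceq f(x)\}$, $\mathrm{Down}(f) = \{x : f(x) \preceq x\}$, and for $x \preceq y$ the sub-instance $L_{x,y} = \{a \in L : x \preceq a \preceq y\}$. A slice is a tuple $s=(s_1,\dots,s_k)$ with $s_i \in \mathbb{N}\cup\{*\}$, with $L_s = \{x \in L : x_i = s_i \text{ whenever } s_i \neq *\}$; a principal slice fixes exactly one coordinate. An inner algorithm takes as input a sub-instance $L_{a,b}$ with $a \preceq b$, $a \in \mathrm{Up}(f)$, $b \in \mathrm{Down}(f)$, and a principal slice $s$ of that sub-instance, and outputs either a point $x \in L_{a,b} \cap L_s$ with $x \in \mathrm{Up}(f)$ or $x \in \mathrm{Down}(f)$, or two points $x,y \in L_{a,b}$ witnessing a violation of order preservation of $f$.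
   Formalization: The bound is proved for q ≥ 1: for q = 0 the claim fails, since on a chain (k = 1) every point lies in Up(f) or Down(f), so an inner algorithm needs no queries, while Tarski needs order log n queries. *)

(* Defs.v *)
From mathcomp Require Import all_boot.

Set Implicit Arguments.
Unset Strict Implicit.
Unset Printing Implicit Defensive.

(* Points carry their original coordinates 1, ..., ns i (not 0, ..., ns i - 1). *)
Definition in_lattice (k : nat) (ns : 'I_k -> nat) (x : {ffun 'I_k -> nat}) : bool :=
  [forall i, 1 <= x i <= ns i].

Definition lattice (k : nat) (ns : 'I_k -> nat) : Type :=
  {x : {ffun 'I_k -> nat} | in_lattice ns x}.

Definition coord (k : nat) (ns : 'I_k -> nat) (x : lattice ns) (i : 'I_k) : nat :=
  sval x i.

Definition width (k : nat) (ns : 'I_k -> nat) : nat := \max_(i < k) ns i.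

(* A slice; [None] stands for the symbol "*", i.e. a free coordinate. *)
Definition slice (k : nat) : Type := {ffun 'I_k -> option nat}.

Definition principal (k : nat) (s : slice k) : bool :=
  #|[set i | s i != None]| == 1.

Section Lattice.

Variables (k : nat) (ns : 'I_k -> nat).

Notation L := (lattice ns).

Definition lat_le (x y : L) : bool := [forall i, coord x i <= coord y i].

Definition Up (f : L -> L) (x : L) : bool := lat_le x (f x).

Definition Down (f : L -> L) (x : L) : bool := lat_le (f x) x.

Definition violation (f : L -> L) (x y : L) : bool :=
  lat_le x y && ~~ lat_le (f x) (f y).

Definition in_sub (a b x : L) : bool := lat_le a x && lat_le x b.

Definition in_slice (s : slice k) (x : L) : bool :=
  [forall i, if s i is Some v then coord x i == v else true].

(* [s] is a slice of the sub-instance between [a] and [b]: the values it fixes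
   are coordinate values occurring in that sub-instance. *)
Definition slice_of_sub (a b : L) (s : slice k) : bool :=
  [forall i, if s i is Some v then coord a i <= v <= coord b i else true].

End Lattice.

(* Deterministic adaptive query algorithms with output in [O], as decision
   trees: [Query x next] evaluates the unknown function at [x] and continues
   with [next (f x)]. *)
Inductive qalg (X O : Type) : Type :=
| Return (o : O)
| Query (x : X) (next : X -> qalg X O).

Fixpoint result (X O : Type) (f : X -> X) (t : qalg X O) : O :=
  match t with
  | Return o => o
  | Query x next => result f (next (f x))
  end.

Fixpoint queries (X O : Type) (f : X -> X) (t : qalg X O) : nat :=
  match t with
  | Return _ => 0
  | Query x next => (queries f (next (f x))).+1
  end.

Section Algorithms.

Variables (k : nat) (ns : 'I_k -> nat).

Notation L := (lattice ns).

(* [inl x] claims that [x] is a fixed point, [inr (x, y)] that [x] and [y]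
   witness a violation of order preservation. *)
Definition tarski_solution (f : L -> L) (o : L + L * L) : Prop :=
  match o with
  | inl x => f x = x
  | inr (x, y) => violation f x y
  end.

(* The output [inl x] does not say which of [Up f], [Down f] the point [x]
   belongs to. On a chain every point is in one of them, so an inner algorithm
   may make no query at all; a bound proportional to the number q of inner
   queries is thus only meaningful for q >= 1. *)
Definition inner_solution (f : L -> L) (a b : L) (s : slice k) (o : L + L * L)
    : Prop :=
  match o with
  | inl x => [/\ in_sub a b x, in_slice s x & Up f x \/ Down f x]
  | inr (x, y) => [/\ in_sub a b x, in_sub a b y & violation f x y]
  end.

(* Correctness and the query bound are only required on inputs satisfying the
   promise. *)
Definition inner_algorithm (q : nat)
    (A : L -> L -> slice k -> qalg L (L + L * L)) : Prop :=
  forall (f : L -> L) (a b : L) (s : slice k),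
    lat_le a b -> Up f a -> Down f b -> principal s -> slice_of_sub a b s ->
    inner_solution f a b s (result f (A a b s)) /\ queries f (A a b s) <= q.

End Algorithms.

(* Main.v *)
(** Keep a box [a <= b] with [a] in [Up f] and [b] in [Down f], starting from
    the whole lattice.  While some side has length at least 2, run the inner
    algorithm on the slice through the middle of that side: the returned point
    replaces [a] or [b] and lowers the rounded-up binary logarithm of the side,
    while no other side grows.  Hence there are at most [k * up_log 2 (n - 1)]
    rounds.  Once every side has length at most 1, the orbit of [a] under [f]
    either leaves the box, stops increasing, or reaches a fixed point within
    [k + 1] queries. *)
Require Import Defs.
From mathcomp Require Import all_boot all_order all_algebra.
From mathcomp Require Import reals exp.
From mathcomp Require Import zify lra.

Set Implicit Arguments.
Unset Strict Implicit.
Unset Printing Implicit Defensive.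

(* [vector] also exports a [coord]. *)
Local Notation coord := Defs.coord.

(** Both roundings go up: with the rounded-down logarithm the drop fails at [d = 3], whose
    rounded-up half is 2. *)
Lemma uphalf_up_log_lt (d : nat) : 1 < d -> up_log 2 (uphalf d) < up_log 2 d.
Proof. by case: d => [|[|n]] // _; rewrite [ltnRHS]up_log2S. Qed.

Section QueryAlgorithms.
Variables (X O P : Type).

Fixpoint qbind (t : qalg X O) (g : O -> qalg X P) : qalg X P :=
  match t with
  | Return o => g o
  | Query x next => Query x (fun y => qbind (next y) g)
  end.

Lemma result_qbind f t g : result f (qbind t g) = result f (g (result f t)).
Proof. by elim: t => //= x next IH; rewrite IH. Qed.

Lemma queries_qbind f t g :
  queries f (qbind t g) = queries f t + queries f (g (result f t)).
Proof. by elim: t => //= x next IH; rewrite IH. Qed.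

End QueryAlgorithms.

Section LatticeOrder.
Variables (k : nat) (ns : 'I_k -> nat).
Local Notation L := (lattice ns).

Lemma lat_leP (x y : L) : reflect (forall i, coord x i <= coord y i) (lat_le x y).
Proof. exact: forallP. Qed.

Lemma lat_le_refl (x : L) : lat_le x x.
Proof. exact/lat_leP. Qed.

Lemma lat_le_trans (y x z : L) : lat_le x y -> lat_le y z -> lat_le x z.
Proof.
by move=> /lat_leP xy /lat_leP yz; apply/lat_leP=> i; exact: leq_trans (yz i).
Qed.

Lemma lat_le_anti (x y : L) : lat_le x y -> lat_le y x -> x = y.
Proof.
move=> /lat_leP xy /lat_leP yx; apply: val_inj; apply/ffunP=> i.
by apply/eqP; rewrite eqn_leq; apply/andP; split; [exact: xy|exact: yx].
Qed.

Definition rank (x : L) : nat := \sum_i coord x i.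

Lemma rank_lt (x y : L) : lat_le x y -> ~~ lat_le y x -> rank x < rank y.
Proof.
move=> /lat_leP xy /forallPn[i]; rewrite -ltnNge => ltxy.
rewrite /rank (bigD1 i) //= [ltnRHS](bigD1 i) //= -addSn leq_add //.
by apply: leq_sum => j _.
Qed.

Lemma rank_le (x y : L) : lat_le x y -> rank x <= rank y.
Proof. by move=> /lat_leP xy; apply: leq_sum => i _. Qed.

Definition gap (a b : L) (i : 'I_k) : nat := coord b i - coord a i.

Lemma gap_sub (a b a' b' : L) i :
  lat_le a a' -> lat_le b' b -> gap a' b' i <= gap a b i.
Proof. by move=> /lat_leP/(_ i) aa' /lat_leP/(_ i) bb'; exact: leq_sub. Qed.

(** Potential bounding the number of rounds of [shrink]. Sides of length 0 and 1 both contribute 0,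
    so it vanishes exactly on boxes ready for [climb]. *)
Definition log_volume (a b : L) : nat := \sum_i up_log 2 (gap a b i).

Lemma log_volume_lt (a b a' b' : L) i :
    lat_le a a' -> lat_le b' b -> 1 < gap a b i ->
    gap a' b' i <= uphalf (gap a b i) ->
  log_volume a' b' < log_volume a b.
Proof.
move=> aa' bb' gap1 gapi.
rewrite /log_volume (bigD1 i) //= [ltnRHS](bigD1 i) //= -addSn leq_add //.
  exact: leq_ltn_trans (leq_up_log 2 gapi) (uphalf_up_log_lt gap1).
by apply: leq_sum => j _; apply: leq_up_log; exact: gap_sub.
Qed.

Definition point_slice (i : 'I_k) (v : nat) : slice k :=
  [ffun j => if j == i then Some v else None].

Lemma principal_point_slice i v : principal (point_slice i v).
Proof.
rewrite /principal (_ : [set j | _] = [set i]) ?cards1 //.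
by apply/setP=> j; rewrite !inE ffunE; case: (j == i).
Qed.

Lemma point_slice_of_sub (a b : L) i v :
  coord a i <= v <= coord b i -> slice_of_sub a b (point_slice i v).
Proof. by move=> vab; apply/forallP=> j; rewrite ffunE; case: eqP => [->|]. Qed.

Lemma in_point_slice (x : L) i v : in_slice (point_slice i v) x -> coord x i = v.
Proof. by move/forallP/(_ i); rewrite ffunE eqxx => /eqP. Qed.

Definition middle (a b : L) i : nat := (coord a i + coord b i)./2.

Lemma middle_bounds (a b : L) i :
  lat_le a b -> coord a i <= middle a b i <= coord b i.
Proof. by move=> /lat_leP/(_ i); rewrite /middle; lia. Qed.

Lemma gap_middle_l (a b x : L) i :
  coord x i = middle a b i -> gap x b i <= uphalf (gap a b i).
Proof. by rewrite /gap /middle => ->; lia. Qed.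

Lemma gap_middle_r (a b x : L) i :
  coord x i = middle a b i -> gap a x i <= uphalf (gap a b i).
Proof. by rewrite /gap /middle => ->; lia. Qed.

Hypothesis ns_gt0 : forall i, 0 < ns i.

Lemma in_lattice_bot : in_lattice ns [ffun=> 1].
Proof. by apply/forallP=> i; rewrite ffunE ns_gt0. Qed.

Lemma in_lattice_top : in_lattice ns [ffun i => ns i].
Proof. by apply/forallP=> i; rewrite ffunE ns_gt0 /=. Qed.

Definition lat_bot : L := exist (in_lattice ns) _ in_lattice_bot.
Definition lat_top : L := exist (in_lattice ns) _ in_lattice_top.

Lemma lat_bot_le x : lat_le lat_bot x.
Proof.
apply/lat_leP=> i; rewrite /coord /= ffunE.
by have /forallP/(_ i)/andP[] := svalP x.
Qed.

Lemma lat_le_top x : lat_le x lat_top.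
Proof.
apply/lat_leP=> i; rewrite /coord /= ffunE.
by have /forallP/(_ i)/andP[] := svalP x.
Qed.

Lemma log_volume_bot_top :
  log_volume lat_bot lat_top <= k * up_log 2 (width ns).-1.
Proof.
rewrite -[leqRHS](_ : \sum_(i < k) up_log 2 (width ns).-1 = _); last first.
  by rewrite sum_nat_const card_ord.
apply: leq_sum => i _; apply: leq_up_log.
(* Coordinates start at 1, so a full side has length [ns i - 1]. *)
by rewrite /gap /coord /= !ffunE subn1 -!subn1 leq_sub2r // leq_bigmax.
Qed.

End LatticeOrder.

Section Reduction.
Variables (k : nat) (ns : 'I_k -> nat).
Local Notation L := (lattice ns).

(* [p] is the point preceding [x] in the orbit: together they witness a
   violation when [x] turns out not to be in [Up f]. *)
Fixpoint climb (m : nat) (p x b : L) : qalg L (L + L * L) :=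
  if m isn't m'.+1 then Return _ (inl x) else
  Query x (fun y =>
    if ~~ lat_le x y then Return _ (inr (p, x))
    else if lat_le y x then Return _ (inl x)
    else if lat_le y b then climb m' x y b
    else Return _ (inr (x, b))).

(** Membership of [x] in [Up f] is unknown before [x] is queried, hence the disjunctive invariant. A
    query that does not end the search moves on to [f x], which has larger rank and is still below
    [b]. *)
Lemma climb_correct (f : L -> L) m p x b :
    Up f x \/ violation f p x -> lat_le x b -> Down f b -> rank b < rank x + m ->
  tarski_solution f (result f (climb m p x b)) /\ queries f (climb m p x b) <= m.
Proof.
move=> + + Db; elim: m p x => [|m IH] p x Ux xb rkm /=.
  (* The fallback answer at fuel 0 is never reached, since [x] below [b] bounds its rank. *)
  by move: rkm; rewrite addn0 ltnNge rank_le.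
have [xfx|nUx] /= := boolP (lat_le x (f x)); last first.
  by case: Ux => [Ux|//]; rewrite /Up (negbTE nUx) in Ux.
have [fxx|nfxx] := boolP (lat_le (f x) x); first by split=> //=; exact: lat_le_anti.
have [fxb|nfxb] /= := boolP (lat_le (f x) b); last first.
  split=> //; rewrite /violation xb /=.
  (* Order preservation would give [f x <= f b <= b]. *)
  by apply: contra nfxb => fxfb; exact: lat_le_trans Db.
apply: IH => //.
  (* As [x <= f x], failure of [f x <= f (f x)] makes [x] and [f x] a violation. *)
  by rewrite /violation xfx /Up /=; case: (lat_le (f x) _); [left|right].
have := rank_lt xfx nfxx; lia.
Qed.

Variable A : L -> L -> slice k -> qalg L (L + L * L).

(** The additional query at [x] decides which corner [x] replaces, so a round costs up to [q.+1]
    queries. *)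
Fixpoint shrink (m : nat) (a b : L) : qalg L (L + L * L) :=
  if m isn't m'.+1 then climb k.+1 a a b else
  if [pick i | 1 < gap a b i] is Some i then
    qbind (A a b (point_slice i (middle a b i))) (fun o =>
      match o with
      | inl x => Query x (fun y =>
          if lat_le x y then shrink m' x b else shrink m' a x)
      | inr v => Return _ (inr v)
      end)
  else climb k.+1 a a b.

Lemma climb_unit_box (f : L -> L) a b :
    lat_le a b -> Up f a -> Down f b -> (forall i, gap a b i <= 1) ->
  tarski_solution f (result f (climb k.+1 a a b)) /\
  queries f (climb k.+1 a a b) <= k.+1.
Proof.
move=> ab Ua Db gap1; apply: climb_correct => //; first by left.
(* Each of the [k] sides adds at most 1 to the rank, so [rank b <= rank a + k]. *)
rewrite addnS ltnS /rank -[X in _ <= _ + X](_ : \sum_(i < k) 1 = _); last first.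
  by rewrite sum1_card card_ord.
by rewrite -big_split /=; apply: leq_sum => i _; rewrite -leq_subLR; exact: gap1.
Qed.

Lemma shrink_correct (q : nat) (f : L -> L) m a b :
    inner_algorithm q A ->
    lat_le a b -> Up f a -> Down f b -> log_volume a b <= m ->
  tarski_solution f (result f (shrink m a b)) /\
  queries f (shrink m a b) <= m * q.+1 + k.+1.
Proof.
move=> innerA; elim: m a b => [|m IH] a b ab Ua Db vol /=.
  apply: climb_unit_box => // i; rewrite leqNgt; apply/negP => gap1.
  (* A side longer than 1 has a positive [up_log], which a zero potential excludes. *)
  move: vol; rewrite leqn0 sum_nat_eq0 => /forallP/(_ i)/=.
  by have := uphalf_up_log_lt gap1; case: (up_log 2 (gap a b i)).
case: pickP => [i gap1|nogap]; last first.
  have [|? qs] := @climb_unit_box f a b ab Ua Db.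
    by move=> i; rewrite leqNgt nogap.
  by split=> //; exact: leq_trans qs (leq_addl _ _).
set s := point_slice i _.
have [] := innerA f a b s ab Ua Db (principal_point_slice _ _)
  (point_slice_of_sub (middle_bounds _ ab)).
rewrite result_qbind queries_qbind.
case: (result f _) => [x|[x y]] /=; last by case=> _ _ xy qs; split=> //; lia.
move=> [/andP[ax xb] /in_point_slice xi UDx] qs.
have half b' a' : lat_le a a' -> lat_le b' b ->
    gap a' b' i <= uphalf (gap a b i) -> log_volume a' b' <= m.
  by move=> aa' bb' /(log_volume_lt aa' bb' gap1)/leq_trans/(_ vol).
have [Ux|nUx] := boolP (lat_le x (f x)).
  have [|? ?] := IH x b xb Ux Db; last by split=> //; lia.
  by apply: half => //; [exact: lat_le_refl|exact: gap_middle_l].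
have Dx : Down f x by case: UDx => // Ux; rewrite /Up (negbTE nUx) in Ux.
have [|? ?] := IH a x ax Ua Dx; last by split=> //; lia.
by apply: half => //; [exact: lat_le_refl|exact: gap_middle_r].
Qed.

End Reduction.

Local Open Scope ring_scope.
Import Order.TTheory GRing.Theory Num.Theory.

(** For [n >= 3], writing [u] for the [up_log], minimality gives [2 ^ (u - 1) < n - 1], so
    [(u - 1) * ln 2 <= ln n]; the remaining [ln 2] is again at most [ln n], whence the factor 2. *)
Lemma up_log_le_ln (R : realType) (n : nat) :
  (up_log 2 n.-1)%:R * ln 2%:R <= 2%:R * ln n%:R :> R.
Proof.
case: n => [|[|[|n]]]; rewrite ?up_log0 ?up_log1 ?mul0r ?ln1 ?mulr0 //=.
(* At [n = 0] the convention [ln 0 = 0] applies. *)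
- by rewrite ln0 ?mulr0.
- by rewrite mulr_ge0 // ln_ge0 // ler1n.
have /andP[lo _] : (2 ^ (up_log 2 n.+2).-1 < n.+2 <= 2 ^ up_log 2 n.+2)%N.
  exact: up_log_bounds.
have u0 : (0 < up_log 2 n.+2)%N by rewrite up_log_gt0.
have ln_lo : (up_log 2 n.+2).-1%:R * ln 2%:R <= ln n.+3%:R :> R.
  rewrite mulr_natl -lnXn ?ltr0n // ler_ln ?posrE ?exprn_gt0 ?ltr0n //.
  by rewrite -natrX ler_nat; lia.
have ln2n : ln 2%:R <= ln n.+3%:R :> R by rewrite ler_ln ?posrE ?ltr0n ?ler_nat.
by rewrite -(prednK u0) -natr1 mulrDl mul1r; lra.
Qed.

Theorem theorem5 (R : realType) :
  exists C : R,
  forall (k : nat) (ns : 'I_k -> nat) (q : nat),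
    (0 < k)%N -> (forall i, (0 < ns i)%N) -> (0 < q)%N ->
    (exists A : lattice ns -> lattice ns -> slice k ->
                qalg (lattice ns) (lattice ns + lattice ns * lattice ns),
       inner_algorithm q A) ->
    exists T : qalg (lattice ns) (lattice ns + lattice ns * lattice ns),
    forall f : lattice ns -> lattice ns,
      tarski_solution f (result f T) /\
      (queries f T)%:R <= C * (q%:R * k%:R * ln (width ns)%:R + k%:R).
Proof.
have ln2 : 0 < ln 2%:R :> R by rewrite ln_gt0 // ltr1n.
(* The count is at most [2 * q * k * u + 2 * k] with [u <= (2 / ln 2) * ln (width ns)]; the two
   summands of the constant cover these two terms. *)
exists (4%:R / ln 2%:R + 2%:R) => k ns q k0 ns0 q0 [A innerA].
set u := up_log 2 (width ns).-1.
exists (shrink A (k * u) (lat_bot ns0) (lat_top ns0)) => f.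
have [||||sol qs] := shrink_correct (m := (k * u)%N) innerA (f := f)
  (a := lat_bot ns0) (b := lat_top ns0).
- exact: lat_bot_le.
- exact: lat_bot_le.
- exact: lat_le_top.
- exact: log_volume_bot_top.
split=> //.
(* Positivity of [q] and [k] turns [q + 1] into [2 * q] and [k + 1] into [2 * k]. *)
have : (queries f (shrink A (k * u) (lat_bot ns0) (lat_top ns0)) <=
        2 * (q * k) * u + 2 * k)%N by apply: leq_trans qs _; nia.
rewrite -(ler_nat R) => /le_trans; apply.
have u_ln : u%:R <= 2%:R / ln 2%:R * ln (width ns)%:R :> R.
  by rewrite mulrAC ler_pdivlMr // up_log_le_ln.
have w0 : 0 <= ln (width ns)%:R :> R.
  by rewrite ln_ge0 // ler1n (leq_trans (ns0 (Ordinal k0))) // leq_bigmax.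
rewrite natrD !natrM mulrDr lerD //; last first.
  by rewrite ler_wpM2r ?ler0n // lerDr divr_ge0 ?ler0n // ltW.
rewrite mulrAC [leRHS]mulrCA mulrC ler_wpM2l ?mulr_ge0 ?ler0n //.
apply: (@le_trans _ _ (2%:R * (2%:R / ln 2%:R * ln (width ns)%:R))).
  by rewrite ler_wpM2l.
by have := mulr_ge0 (ler0n R 2) w0; lra.
Qed.
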